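(* Let $K$ be a field and let $A$ be a unital $K$-algebra. Let $a\in A$ and let $d\in A$ be regular, such that $a$ is invertible along $d$, and let $t\in K$, $t\neq 0$. Then $da+t(da)^\pi$ is invertible and $$a^{\parallel d} = (da+t (da)^\pi)^{-1}d.$$
   Context: Algebras are associative with unit $1$. An element $d\in A$ is regular if there is $d^-\in A$ with $d=dd^-d$. For $a,d\in A$, $a$ is invertible along $d$ if there exists $b\in A$ such that $bab=b$, $bA=dA$ and $Ab=Ad$. Such $b$ is unique when it exists and is denoted $a^{\parallel d}$. It is known that if $a$ is invertible along $d$, then $da$ is group invertible. An element $x$ is group invertible if there is $x^\#\in A$ (necessarily unique) with $xx^\#x=x$, $x^\#xx^\#=x^\#$, $xx^\#=x^\#x$; then its spectral idempotent is $x^\pi=1-xx^\#$. *)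

(* Defs.v *)
From mathcomp Require Import all_boot all_algebra.
From mathcomp Require Import boolp classical_sets.

Set Implicit Arguments.
Unset Strict Implicit.
Unset Printing Implicit Defensive.

Import GRing.Theory.
Local Open Scope classical_set_scope.
Local Open Scope ring_scope.

(* The rings here carry no unitRingType structure, so inverses are described
   by predicates and then selected by [xget 0], which returns the unique element
   satisfying the predicate when there is one, and 0 otherwise. *)
Section Inverses.
Variable A : pzRingType.
Implicit Types a b c d x y z : A.

Definition regular_elt d : Prop := exists e : A, d = d * e * d.

Definition is_two_sided_inverse x y : Prop := x * y = 1 /\ y * x = 1.

Definition invertible x : Prop := exists y, is_two_sided_inverse x y.

Definition two_sided_inverse x : A := xget 0 (is_two_sided_inverse x).

Definition is_group_inverse x y : Prop :=
  [/\ x * y * x = x, y * x * y = y & x * y = y * x].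

Definition group_invertible x : Prop := exists y, is_group_inverse x y.

Definition group_inverse x : A := xget 0 (is_group_inverse x).

Definition spectral_idempotent x : A := 1 - x * group_inverse x.

(* [range ( *%R b)] is the right ideal bA and [range ( *%R^~ b)] is the
   left ideal Ab. *)
Definition is_inverse_along a d b : Prop :=
  [/\ b * a * b = b,
      range ( *%R b) = range ( *%R d) &
      range ( *%R^~ b) = range ( *%R^~ d)].

Definition invertible_along a d : Prop := exists b, is_inverse_along a d b.

Definition inverse_along a d : A := xget 0 (is_inverse_along a d).

Lemma is_two_sided_inverse_uniq x y z :
  is_two_sided_inverse x y -> is_two_sided_inverse x z -> y = z.
Proof.
by move=> [_ yx] [xz _]; rewrite -[y]mulr1 -xz mulrA yx mul1r.
Qed.

Lemma is_group_inverse_uniq x y z :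
  is_group_inverse x y -> is_group_inverse x z -> y = z.
Proof.
move=> [xyx yxy xy] [xzx zxz xz].
have exz : x * y = x * z.
  by rewrite xy -{1}xzx -mulrA -xz !mulrA -xy xyx.
by rewrite -yxy -mulrA exz mulrA -xy exz xz.
Qed.

Lemma is_inverse_along_uniq a d b c :
  is_inverse_along a d b -> is_inverse_along a d c -> b = c.
Proof.
move=> [bab bA Ab] [cac cA Ac].
have [u _ cu] : range ( *%R c) b by rewrite cA -bA; exists 1; rewrite ?mulr1.
have [v _ vb] : range ( *%R^~ b) c by rewrite Ab -Ac; exists 1; rewrite ?mul1r.
transitivity (c * a * b); first by rewrite -cu mulrA cac.
by rewrite -vb -!mulrA (mulrA b) bab.
Qed.

Lemma invertible_along_group_invertible a d :
  invertible_along a d -> group_invertible (d * a).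
Proof.
move=> [b [bab bA Ab]].
have [u _ bu] : range ( *%R d) b by rewrite -bA; exists 1; rewrite ?mulr1.
have [v _ vd] : range ( *%R^~ d) b by rewrite -Ab; exists 1; rewrite ?mul1r.
have [x _ bx] : range ( *%R b) d by rewrite bA; exists 1; rewrite ?mulr1.
have [y _ yb] : range ( *%R^~ b) d by rewrite Ab; exists 1; rewrite ?mul1r.
have bad : b * a * d = d by rewrite -bx mulrA bab.
have dab : d * a * b = d by rewrite -yb -!mulrA (mulrA b) bab.
have wdu : d * a * d * u = d by rewrite -mulrA bu dab.
have wq : v * (d * a) * (d * a) = d * a by rewrite !mulrA vd bad.
have [w wE] : exists w, w = d * a by exists (d * a).
rewrite -wE in wdu wq *.
have wp : w * w * (d * u * u * a) = w.
  by rewrite !mulrA -(mulrA w w d) -(mulrA w (w * d) u) wdu wdu.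
move: (d * u * u * a) wp => p wp.
have qwE : v * w = w * p by rewrite -{1}wp !mulrA wq.
have wg : w * (v * w * p) = w * p by rewrite qwE !mulrA wp.
have gw : v * w * p * w = w * p by rewrite -(mulrA v w p) -qwE -mulrA wq.
exists (v * w * p); split.
- by rewrite wg -qwE wq.
- by rewrite gw -qwE -mulrA wg mulrA.
- by rewrite wg gw.
Qed.

End Inverses.

(* Main.v *)
Require Import Defs.
From mathcomp Require Import all_boot all_algebra.
From mathcomp Require Import classical_sets.

(* With w = da and e = w w^#, the element w + t (1 - e) has inverse
   w^# + t^-1 (1 - e).  If b is the inverse of a along d, then w b = d, so
   e d = d, and e b = b because bA = dA.  Hence (w + t (1 - e)) b = d, and
   multiplying by the inverse gives b. *)

Import GRing.Theory.
Local Open Scope ring_scope.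

(** Once a witness exists, [xget] picks an element satisfying the predicate rather than falling back
    on its default; the next two lemmas rest on the same fact. *)
Lemma group_inverseP (A : pzRingType) (x : A) :
  group_invertible x -> is_group_inverse x (group_inverse x).
Proof. exact: xgetPex. Qed.

Lemma two_sided_inverseP (A : pzRingType) (x : A) :
  invertible x -> is_two_sided_inverse x (two_sided_inverse x).
Proof. exact: xgetPex. Qed.

Lemma inverse_alongP (A : pzRingType) (a d : A) :
  invertible_along a d -> is_inverse_along a d (inverse_along a d).
Proof. exact: xgetPex. Qed.

(** Equality of the left ideals gives [d = y * b], and [b * a * b = b] then absorbs [a * b] on the
    right. *)
Lemma is_inverse_along_mull (A : pzRingType) (a d b : A) :
  is_inverse_along a d b -> d * a * b = d.
Proof.
move=> [bab _ Ab].
have [y _ <-] : range ( *%R^~ b) d by rewrite Ab; exists 1; rewrite ?mul1r.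
by rewrite -!mulrA (mulrA b) bab.
Qed.

(** Through this factorization, whatever kills [d] from the left also kills [b]. *)
Lemma is_inverse_along_factor (A : pzRingType) (a d b : A) :
  is_inverse_along a d b -> exists u, b = d * u.
Proof.
move=> [_ bA _].
have [u _ <-] : range ( *%R d) b by rewrite -bA; exists 1; rewrite ?mulr1.
by exists u.
Qed.

Lemma spectral_idempotentMl (A : pzRingType) (x : A) :
  group_invertible x -> spectral_idempotent x * x = 0.
Proof.
by move=> /group_inverseP[xgx _ _]; rewrite mulrBl mul1r xgx subrr.
Qed.

Lemma invertible_add_spectral_idempotent (K : fieldType) (A : algType K)
    (x : A) (t : K) :
  group_invertible x -> t != 0 -> invertible (x + t *: spectral_idempotent x).
Proof.
move=> xG t0; have px := spectral_idempotentMl _ _ xG.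
have [xgx gxg xg] := group_inverseP _ _ xG.
set g := group_inverse x in xgx gxg xg; set p := spectral_idempotent x in px *.
(* [p] is idempotent and annihilates [x] and [g] on both sides, so [x] and [t *: p] live in
   complementary corners and are inverted separately. *)
have pE : p = 1 - x * g by [].
have xp : x * p = 0 by rewrite pE xg mulrBr mulr1 mulrA xgx subrr.
have pg : p * g = 0 by rewrite pE xg mulrBl mul1r gxg subrr.
have gp : g * p = 0 by rewrite pE mulrBr mulr1 mulrA gxg subrr.
have pp : p * p = p by rewrite {2}pE mulrBr mulr1 mulrA px mul0r subr0.
exists (g + t^-1 *: p); split.
  (* The mixed products vanish; what remains is [x * g + (t * t^-1) *: p = x * g + p = 1]. *)
  rewrite mulrDl !mulrDr -!scalerAl -!scalerAr xp pg pp !scaler0 addr0 add0r.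
  by rewrite scalerA mulfV // scale1r pE addrC subrK.
rewrite mulrDl !mulrDr -!scalerAl -!scalerAr px gp pp !scaler0 addr0 add0r.
by rewrite scalerA mulVf // scale1r pE -xg addrC subrK.
Qed.

Theorem theorem4p3 (K : fieldType) (A : algType K) (a d : A) (t : K)
    (hd : regular_elt d) (had : invertible_along a d) (ht : t != 0) :
  invertible (d * a + t *: spectral_idempotent (d * a)) /\
  inverse_along a d =
    two_sided_inverse (d * a + t *: spectral_idempotent (d * a)) * d.
Proof.
have daG := invertible_along_group_invertible had.
have Xinv := invertible_add_spectral_idempotent _ _ _ _ daG ht.
split=> //; have bP := inverse_alongP _ _ _ had.
have dab := is_inverse_along_mull _ _ _ _ bP.
have [u bdu] := is_inverse_along_factor _ _ _ _ bP.
have [_ YX] := two_sided_inverseP _ _ Xinv.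
set b := inverse_along a d in dab bdu *.
(* Expanding [d] as [d * a * b] exposes the factor [d * a], which its spectral idempotent kills. *)
have pd : spectral_idempotent (d * a) * d = 0.
  by rewrite -[X in _ * X]dab mulrA spectral_idempotentMl // mul0r.
have Xb : (d * a + t *: spectral_idempotent (d * a)) * b = d.
  by rewrite mulrDl dab bdu -scalerAl mulrA pd mul0r scaler0 addr0.
by rewrite -[X in _ * X]Xb mulrA YX mul1r.
Qed.
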